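(* Let $V$ be a finite set and $f \colon 2^V \to \mathbb{R}$ a submodular function. Let $U_1,\dots,U_k$ be the vertex sets of the connected components of the inequality graph $G_f$, and let $\mathcal{U}(f) = \{ \bigcup_{i \in I} U_i : I \subseteq \{1,\dots,k\}\}$. Then for any $S \subseteq V$, the function $f \circ \sigma_S$ (i.e. $X \mapsto f(X \vartriangle S)$) is submodular if and only if $S \in \mathcal{U}(f)$.
   Context: For $f\colon 2^V \to \mathbb{R}$ and $X,Y \subseteq V$, $\Phi_f(X,Y) = f(X)+f(Y)-f(X\cup Y)-f(X \cap Y)$; $f$ is submodular if $\Phi_f(X,Y) \ge 0$ for all $X,Y$ (no normalization assumed). $X \vartriangle S$ is the symmetric difference. The inequality graph $G_f = (V, E_f)$ is the undirected graph where, for distinct $u,v \in V$, $\{u,v\} \in E_f$ iff there exists $X \subseteq V \setminus \{u,v\}$ with $f(X \cup \{u\}) + f(X \cup \{v\}) - f(X \cup \{u,v\}) - f(X) \neq 0$. *)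

(* Defs.v *)
From HB Require Import structures.
From mathcomp Require Import all_boot all_order all_algebra.
From mathcomp Require Import reals.
Set Implicit Arguments.
Unset Strict Implicit.
Unset Printing Implicit Defensive.
Import Order.TTheory GRing.Theory Num.Theory.
Local Open Scope ring_scope.

Definition Phi (R : realType) (V : finType) (f : {set V} -> R)
    (X Y : {set V}) : R :=
  f X + f Y - f (X :|: Y) - f (X :&: Y).

Definition submodular (R : realType) (V : finType) (f : {set V} -> R) : Prop :=
  forall X Y : {set V}, 0 <= Phi f X Y.

Definition symdiff (V : finType) (S X : {set V}) : {set V} :=
  (X :\: S) :|: (S :\: X).

Definition inequality_graph (R : realType) (V : finType) (f : {set V} -> R) :
    rel V :=
  fun u v => (u != v) &&
    [exists X : {set V}, (X \subset ~: [set u; v]) &&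
      (f (X :|: [set u]) + f (X :|: [set v]) - f (X :|: [set u; v]) - f X
         != 0)].

Lemma inequality_graph_sym (R : realType) (V : finType) (f : {set V} -> R) :
  symmetric (inequality_graph f).
Proof.
move=> u v; rewrite /inequality_graph eq_sym setUC; congr (_ && _).
by apply: eq_existsb => X; rewrite [f _ + f _]addrC.
Qed.

(* For symmetric e, connect e is an equivalence relation whose classes are the
   connected components; isolated vertices give singletons. *)
Definition components (V : finType) (e : rel V) : {set {set V}} :=
  equivalence_partition (connect e) [set: V].

(* Distinct components are distinct sets, so a subset of the set of components
   plays the role of an index set I, and cover is the union. *)
Definition component_unions (R : realType) (V : finType) (f : {set V} -> R) :
    {set {set V}} :=
  [set cover I | I in powerset (components (inequality_graph f))].

(* Main.v *)
Require Import Defs.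
From HB Require Import structures.
From mathcomp Require Import all_boot all_order all_algebra.
From mathcomp Require Import reals.
From mathcomp Require Import ring.
Set Implicit Arguments.
Unset Strict Implicit.
Unset Printing Implicit Defensive.
Import Order.TTheory GRing.Theory Num.Theory.
Local Open Scope ring_scope.

(** Submodularity only has to be tested on pairs [X], [Y] with
    [X :\: Y = {u}] and [Y :\: X = {v}]. On such a pair, passing to
    [f \o symdiff S] keeps the sign of [Phi f] when [u] and [v] lie on the same
    side of [S], and reverses it when [S] separates them. So the flipped
    function is submodular iff [Phi f] vanishes on every pair separated by [S],
    that is, iff no edge of the inequality graph leaves [S]. *)

Lemma PhiC (R : realType) (V : finType) (f : {set V} -> R) (X Y : {set V}) :
  Phi f X Y = Phi f Y X.
Proof. by rewrite /Phi setUC setIC [f X + _]addrC. Qed.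

Lemma Phi_subset (R : realType) (V : finType) (f : {set V} -> R)
    (X Y : {set V}) : X \subset Y -> Phi f X Y = 0.
Proof. by move=> sXY; rewrite /Phi (setUidPr sXY) (setIidPl sXY); ring. Qed.

(** The sum telescopes: adding [a] to [Y] leaves [X :|: Y] unchanged, and the values of [f] at
    [a |: Y] and [a |: X :&: Y] cancel. *)
Lemma Phi_split (R : realType) (V : finType) (f : {set V} -> R)
    (X Y : {set V}) (a : V) : a \in X -> a \notin Y ->
  Phi f X Y = Phi f X (a |: Y) + Phi f (a |: X :&: Y) Y.
Proof.
move=> aX aY; rewrite /Phi.
have -> : X :|: (a |: Y) = X :|: Y.
  by apply/setP=> x; rewrite !inE; case: eqP => // ->; rewrite aX.
have -> : X :&: (a |: Y) = a |: X :&: Y.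
  by apply/setP=> x; rewrite !inE; case: eqP => // ->; rewrite aX.
have -> : a |: X :&: Y :|: Y = a |: Y.
  by apply/setP=> x; rewrite !inE; case: eqP => //= _; case: (x \in Y);
     rewrite ?andbF ?orbT.
have -> : (a |: X :&: Y) :&: Y = X :&: Y.
  apply/setP=> x; rewrite !inE; case: eqP => [->|_] /=.
    by rewrite (negbTE aY) andbF.
  by rewrite -andbA andbb.
ring.
Qed.

Lemma submodular_local (R : realType) (V : finType) (f : {set V} -> R) :
  (forall (X Y : {set V}) (u v : V),
     X :\: Y = [set u] -> Y :\: X = [set v] -> 0 <= Phi f X Y) ->
  submodular f.
Proof.
move=> loc X Y.
have [n] := ubnP (#|X :\: Y| + #|Y :\: X|)%N.
elim: n X Y => // n IHn X Y; rewrite ltnS => le_n.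
(* Once the empty and singleton cases are gone, this order forces [X :\: Y] to have at least two
   elements, so that both pieces of the split are smaller. *)
wlog leYX : X Y le_n / (#|Y :\: X| <= #|X :\: Y|)%N.
  move=> W; case: (leqP #|Y :\: X| #|X :\: Y|) => [|/ltnW] le; first exact: W.
  by rewrite PhiC; apply: W => //; rewrite addnC.
have [Y0|Yn0] := eqVneq (Y :\: X) set0.
  by rewrite PhiC Phi_subset // -setD_eq0 Y0.
have [X1|Xn1] := eqVneq #|X :\: Y| 1%N.
  have /cards1P[u Eu] : #|X :\: Y| == 1%N by rewrite X1.
  have /cards1P[v Ev] : #|Y :\: X| == 1%N.
    by rewrite eqn_leq -{1}X1 leYX card_gt0.
  exact: loc Eu Ev.
have Y_gt0 : (0 < #|Y :\: X|)%N by rewrite card_gt0.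
have X_gt1 : (1 < #|X :\: Y|)%N.
  by rewrite ltn_neqAle eq_sym Xn1 (leq_trans Y_gt0).
have /card_gt0P[a] := ltnW X_gt1; rewrite inE => /andP[aY aX].
rewrite (Phi_split _ aX aY); apply: addr_ge0; apply: IHn.
(* In the first piece [X :\: Y] loses [a] while the other difference does not grow. *)
- apply: leq_trans le_n; rewrite -addSn leq_add //.
    rewrite [in leqRHS](cardsD1 a) inE aY aX /= add1n ltnS subset_leq_card //.
    apply/subsetP=> x; rewrite !inE; case: eqP => //=.
  apply: subset_leq_card; apply/subsetP=> x; rewrite !inE.
  by case: eqP => //= ->; rewrite aX.
(* In the second piece [X :\: Y] shrinks to at most [{a}], which is smaller because it had two
   elements. *)
- apply: leq_trans le_n; rewrite -addSn leq_add //.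
    apply: leq_trans X_gt1; rewrite ltnS -(cards1 a) subset_leq_card //.
    by apply/subsetP=> x; rewrite !inE; case: eqP => //= _; case: (x \in Y);
       rewrite ?andbF.
  apply: subset_leq_card; apply/subsetP=> x; rewrite !inE.
  by case: eqP => //=; case: (x \in Y); rewrite ?andbT ?andbF.
Qed.

Lemma symdiffK (V : finType) (S : {set V}) :
  cancel (symdiff S) (symdiff S).
Proof.
by move=> X; apply/setP=> x; rewrite !inE; case: (x \in S); case: (x \in X).
Qed.

(** [X] and [Y] agree on [S], and the flip changes nothing off [S], so it commutes with union and
    intersection of this pair. *)
Lemma Phi_symdiff_disjoint (R : realType) (V : finType) (f : {set V} -> R)
    (S X Y : {set V}) :
  [disjoint X :\: Y & S] -> [disjoint Y :\: X & S] ->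
  Phi (fun Z => f (symdiff S Z)) X Y = Phi f (symdiff S X) (symdiff S Y).
Proof.
move=> /pred0P dX /pred0P dY; rewrite /Phi.
have -> : symdiff S (X :|: Y) = symdiff S X :|: symdiff S Y.
  apply/setP=> x; have /= := (dX x, dY x); rewrite !inE.
  by case: (x \in S); case: (x \in X); case: (x \in Y); case.
have -> // : symdiff S (X :&: Y) = symdiff S X :&: symdiff S Y.
apply/setP=> x; have /= := (dX x, dY x); rewrite !inE.
by case: (x \in S); case: (x \in X); case: (x \in Y); case.
Qed.

(** [X] and [Y] differ only inside [S], where the flip complements; it therefore swaps their union
    and intersection, which enter [Phi] symmetrically. *)
Lemma Phi_symdiff_subset (R : realType) (V : finType) (f : {set V} -> R)
    (S X Y : {set V}) :
  X :\: Y \subset S -> Y :\: X \subset S ->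
  Phi (fun Z => f (symdiff S Z)) X Y = Phi f (symdiff S X) (symdiff S Y).
Proof.
move=> /subsetP sX /subsetP sY; rewrite /Phi.
have -> : symdiff S (X :|: Y) = symdiff S X :&: symdiff S Y.
  apply/setP=> x; move: (sX x) (sY x); rewrite !inE.
  by case: (x \in S); case: (x \in X); case: (x \in Y) => //= h1 h2;
     (have := h1 isT) || have := h2 isT.
have -> : symdiff S (X :&: Y) = symdiff S X :|: symdiff S Y.
  apply/setP=> x; move: (sX x) (sY x); rewrite !inE.
  by case: (x \in S); case: (x \in X); case: (x \in Y) => //= h1 h2;
     (have := h1 isT) || have := h2 isT.
ring.
Qed.

(** The flip of [Y] contains both differences and the flip of [X] neither, so they become the union
    and intersection of the flips of [X :&: Y] and [X :|: Y]. The two pairs trade places in [Phi],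
    hence the sign. *)
Lemma Phi_symdiff_separated (R : realType) (V : finType) (f : {set V} -> R)
    (S X Y : {set V}) :
  X :\: Y \subset S -> [disjoint Y :\: X & S] ->
  Phi (fun Z => f (symdiff S Z)) X Y =
  - Phi f (symdiff S (X :&: Y)) (symdiff S (X :|: Y)).
Proof.
move=> /subsetP sX /pred0P dY; rewrite /Phi.
have -> : symdiff S (X :&: Y) :|: symdiff S (X :|: Y) = symdiff S Y.
  apply/setP=> x; move: (sX x) (dY x); rewrite /= !inE.
  by case: (x \in S); case: (x \in X); case: (x \in Y) => //= h1 h2;
     (have := h1 isT) || have := h2.
have -> : symdiff S (X :&: Y) :&: symdiff S (X :|: Y) = symdiff S X.
  apply/setP=> x; move: (sX x) (dY x); rewrite /= !inE.
  by case: (x \in S); case: (x \in X); case: (x \in Y) => //= h1 h2;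
     (have := h1 isT) || have := h2.
ring.
Qed.

(** Edges are put in terms of the same pairs as in [submodular_local]; the set in the definition of
    the graph is [X :&: Y]. *)
Lemma inequality_graphP (R : realType) (V : finType) (f : {set V} -> R)
    (u v : V) :
  reflect (exists X Y : {set V},
             [/\ X :\: Y = [set u], Y :\: X = [set v] & Phi f X Y != 0])
          (inequality_graph f u v).
Proof.
apply: (iffP andP) => [[uv /existsP[X /andP[/subsetP sX nz]]]|].
  have uX : u \notin X by apply/negP=> /sX; rewrite !inE eqxx.
  have vX : v \notin X by apply/negP=> /sX; rewrite !inE eqxx orbT.
  exists (X :|: [set u]), (X :|: [set v]); split.
  - apply/setP=> x; rewrite !inE; case: (eqVneq x u) => [->|_].
      by rewrite (negbTE uX) (negbTE uv).
    by rewrite orbF; case: (x \in X); rewrite ?andbF.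
  - apply/setP=> x; rewrite !inE; case: (eqVneq x v) => [->|_].
      by rewrite (negbTE vX) eq_sym (negbTE uv).
    by rewrite orbF; case: (x \in X); rewrite ?andbF.
  - rewrite /Phi -setUUr -setUIr.
    have -> : [set u] :&: [set v] = set0.
      by apply/setP=> x; rewrite !inE; case: eqP => // ->; rewrite (negbTE uv).
    by rewrite setU0.
case=> X [Y [EX EY nz]].
have XU : X :&: Y :|: [set u] = X by rewrite -EX setID.
have YV : X :&: Y :|: [set v] = Y by rewrite -EY setIC setID.
have /setDP[uX uY] : u \in X :\: Y by rewrite EX set11.
have /setDP[vY vX] : v \in Y :\: X by rewrite EY set11.
split; first by apply: contraNneq vX => <-.
apply/existsP; exists (X :&: Y); apply/andP; split.
  apply/subsetP=> x; rewrite !inE => /andP[xX xY]; apply/norP; split.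
    by apply: contraNneq uY => <-.
  by apply: contraNneq vX => <-.
by rewrite setUUr XU YV.
Qed.

Lemma component_unionsP (R : realType) (V : finType) (f : {set V} -> R)
    (S : {set V}) :
  S \in component_unions f <-> closed (inequality_graph f) (mem S).
Proof.
have csym := sym_connect_sym (inequality_graph_sym f).
split=> [/imsetP[I]|clS].
  rewrite inE => /subsetP sI ->; apply: (intro_closed csym) => u v uv.
  case/bigcupP=> B BI uB; apply/bigcupP; exists B => //.
  case/imsetP: (sI B BI) uB => w _ ->; rewrite !inE /= => wu.
  exact: connect_trans wu (connect1 uv).
(* The components inside [S] cover it: a closed set contains the whole component of each of its
   points. *)
apply/imsetP; exists [set B in components (inequality_graph f) | B \subset S].
  by rewrite inE; apply/subsetP=> B; rewrite inE => /andP[].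
apply/setP=> x; apply/idP/bigcupP=> [xS|[B]]; last first.
  by rewrite inE => /andP[_ /subsetP sB] /sB.
exists [set y in [set: V] | connect (inequality_graph f) x y]; last first.
  by rewrite !inE connect0.
rewrite inE; apply/andP; split; first by apply/imsetP; exists x; rewrite ?inE.
apply/subsetP=> y; rewrite !inE /= => xy.
by have := closed_connect clS xy; rewrite /= xS => <-.
Qed.

Theorem theorem3p7 (R : realType) (V : finType) (f : {set V} -> R)
    (hf : submodular f) (S : {set V}) :
  submodular (fun X : {set V} => f (symdiff S X)) <->
  S \in component_unions f.
Proof.
apply: iff_trans (iff_sym (component_unionsP f S)).
split=> [hg|clS].
  apply: (intro_closed (sym_connect_sym (inequality_graph_sym f))) => u v.
  case/inequality_graphP=> X [Y [EX EY nz]] uS.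
  apply: contraNT nz => vS.
  (* Since flipping is an involution, [f] is itself the flip of a submodular function. The separated
     case then gives [Phi f X Y <= 0], so [hf] forces equality. *)
  have gK Z : f Z = f (symdiff S (symdiff S Z)) by rewrite symdiffK.
  have := @Phi_symdiff_separated R V (fun Z => f (symdiff S Z)) S X Y.
  rewrite EX EY sub1set disjoints1 => /(_ uS vS).
  rewrite {1}/Phi -!gK -/(Phi f X Y) => E.
  by rewrite eq_le hf andbT E oppr_le0 hg.
have Phi0 X Y u v : X :\: Y = [set u] -> Y :\: X = [set v] ->
    (u \in S) != (v \in S) -> Phi f X Y = 0.
  move=> EX EY; apply: contraNeq => nz.
  by apply/eqP/clS/inequality_graphP; exists X, Y.
have sep X Y u v : X :\: Y = [set u] -> Y :\: X = [set v] ->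
    u \in S -> v \notin S -> Phi (fun Z => f (symdiff S Z)) X Y = 0.
  move=> EX EY uS vS.
  rewrite Phi_symdiff_separated ?EX ?EY ?sub1set ?disjoints1 //.
  apply/eqP; rewrite oppr_eq0; apply/eqP.
  have inX x := congr1 (fun A : {set V} => x \in A) EX.
  have inY x := congr1 (fun A : {set V} => x \in A) EY.
  (* The flips of [X :&: Y] and [X :|: Y] again differ by exactly [u] on one side and [v] on the
     other, so [Phi0] applies to them. *)
  apply: (Phi0 _ _ u v); last by rewrite uS (negbTE vS).
  1,2: apply/setP=> x; rewrite -?[in RHS]EX -?[in RHS]EY.
  1,2: move: (inX x) (inY x); rewrite !inE.
  1,2: have [->|_] := eqVneq x u; first by rewrite uS; do 2 case: (_ \in _).
  1,2: have [->|_] := eqVneq x v;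
         first by rewrite (negbTE vS); do 2 case: (_ \in _).
  1,2: by case: (x \in S); case: (x \in X); case: (x \in Y).
apply: submodular_local => X Y u v EX EY.
case uS: (u \in S); case vS: (v \in S).
- by rewrite Phi_symdiff_subset ?EX ?EY ?sub1set.
- by rewrite (sep X Y u v) ?vS.
- by rewrite PhiC (sep Y X v u) ?uS.
- by rewrite Phi_symdiff_disjoint ?EX ?EY ?disjoints1 ?uS ?vS.
Qed.
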